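(* Let $X$ be the real or complex sequence space $l_p$ ($1\le p<\infty$) or $(c_0,\|\cdot\|_\infty)$, with scalar field $\mathbb{F}=\mathbb{R}$ or $\mathbb{F}=\mathbb{C}$, and let $\lambda\in\mathbb{F}$ with $|\lambda|>1$ be arbitrary. Then the weighted backward shift \[ D(A)\ni x:=(x_k)_{k\in\mathbb{N}}\ \mapsto\ Ax:=(\lambda^kx_{k+1})_{k\in\mathbb{N}}, \] with the domain \[ D(A):=\left\{(x_k)_{k\in\mathbb{N}}\in X\ \middle|\ (\lambda^kx_{k+1})_{k\in\mathbb{N}}\in X\right\}, \] is a chaotic unbounded linear operator in $X$.
   Context: $\mathbb{N}=\{1,2,\dots\}$, $\mathbb{Z}_+=\{0,1,2,\dots\}$. $c_0$ is the space of sequences $(x_k)_{k\in\mathbb{N}}$ converging to zero, with the norm $\|x\|_\infty:=\sup_{k\in\mathbb{N}}|x_k|$; $l_p$ carries its usual $p$-norm. Let $A:X\supseteq D(A)\to X$ be a (bounded or unbounded) linear operator in a Banach space $X$, with powers $A^n$ defined on their natural (iterated) domains $D(A^n)$, $A^0:=I$ the identity operator. Put $C^\infty(A):=\bigcap_{n=0}^\infty D(A^n)$. A nonzero vector $x\in C^\infty(A)$ is called hypercyclic for $A$ if its orbit $\{A^nx\}_{n\in\mathbb{Z}_+}$ is dense in $X$; $A$ is hypercyclic if it possesses a hypercyclic vector. A vector $x$ is a periodic point of $A$ if there is $N\in\mathbb{N}$ with $x\in D(A^N)$ and $A^Nx=x$. $A$ is chaotic if it is hypercyclic and its set of periodic points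 is dense in $X$. *)

(* Defs.v *)
From Stdlib Require Import Reals Lra Lia ssreflect.
From Stdlib Require Import ClassicalEpsilon FunctionalExtensionality
  PropExtensionality ProofIrrelevance.
From Coquelicot Require Import Coquelicot.

Open Scope R_scope.

(** Only the restriction of [app] to [dom] is meaningful. *)
Record operator {K : AbsRing} (V : CompleteNormedModule K) : Type := Operator {
  dom : V -> Prop;
  app : V -> V
}.
Arguments Operator {K V} dom app.
Arguments dom {K V} o x.
Arguments app {K V} o x.

Section OperatorTheory.
Context {K : AbsRing} {V : CompleteNormedModule K}.
Implicit Types A B : operator V.

Definition linear_operator A : Prop :=
  dom A zero /\
  (forall x y, dom A x -> dom A y ->
     dom A (plus x y) /\ app A (plus x y) = plus (app A x) (app A y)) /\
  (forall (a : K) x, dom A x ->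
     dom A (scal a x) /\ app A (scal a x) = scal a (app A x)).

Definition bounded_operator A : Prop :=
  exists M : R, forall x, dom A x -> norm (app A x) <= M * norm x.

Definition op_id : operator V := Operator (fun _ => True) (fun x => x).

Definition op_comp B A : operator V :=
  Operator (fun x => dom A x /\ dom B (app A x)) (fun x => app B (app A x)).

Fixpoint op_pow A (n : nat) : operator V :=
  match n with
  | O => op_id
  | S m => op_comp A (op_pow A m)
  end.

Definition C_infty A (x : V) : Prop := forall n : nat, dom (op_pow A n) x.

Definition dense (S : V -> Prop) : Prop :=
  forall (y : V) (eps : posreal), exists z : V, S z /\ ball y eps z.

Definition orbit A (x z : V) : Prop := exists n : nat, z = app (op_pow A n) x.

Definition hypercyclic_vector A (x : V) : Prop :=
  x <> zero /\ C_infty A x /\ dense (orbit A x).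

Definition hypercyclic A : Prop := exists x : V, hypercyclic_vector A x.

Definition periodic_point A (x : V) : Prop :=
  exists N : nat, (1 <= N)%nat /\ dom (op_pow A N) x /\ app (op_pow A N) x = x.

Definition chaotic A : Prop := hypercyclic A /\ dense (periodic_point A).

End OperatorTheory.

(** [Rpower 0 p] is [1] in the standard library, hence the case distinction. *)
Definition rpow (t p : R) : R :=
  match Req_EM_T t 0 with
  | left _ => 0
  | right _ => Rpower t p
  end.

Lemma rpow0 p : rpow 0 p = 0.
Proof. rewrite /rpow; case: Req_dec_T => //; lra. Qed.

Lemma rpow_pos t p : 0 < t -> rpow t p = Rpower t p.
Proof. rewrite /rpow; case: Req_dec_T => //; lra. Qed.

Lemma rpow_gt0 t p : 0 < t -> 0 < rpow t p.
Proof. move=> h; rewrite rpow_pos //; exact: exp_pos. Qed.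

Lemma rpow_ge0 t p : 0 <= rpow t p.
Proof.
rewrite /rpow; case: Req_dec_T => _; first lra.
apply: Rlt_le; exact: exp_pos.
Qed.

Lemma rpow_le s t p : 0 <= p -> 0 <= s <= t -> rpow s p <= rpow t p.
Proof.
move=> hp [h0 h]; case: (Req_dec s 0) => [->|hs].
  rewrite rpow0; exact: rpow_ge0.
rewrite !rpow_pos; try lra.
apply: Rle_Rpower_l => //; lra.
Qed.

Lemma rpowM s t p : 0 <= s -> 0 <= t -> rpow (s * t) p = rpow s p * rpow t p.
Proof.
move=> hs ht; case: (Req_dec s 0) => [->|hs'].
  by rewrite Rmult_0_l rpow0 Rmult_0_l.
case: (Req_dec t 0) => [->|ht']; first by rewrite Rmult_0_r rpow0 Rmult_0_r.
rewrite !rpow_pos; try lra; last by apply: Rmult_lt_0_compat; lra.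
rewrite Rpower_mult_distr //; lra.
Qed.

Lemma rpowK t p : p <> 0 -> 0 <= t -> rpow (rpow t p) (/ p) = t.
Proof.
move=> hp ht; case: (Req_dec t 0) => [->|h]; first by rewrite !rpow0.
rewrite rpow_pos; last by apply: rpow_gt0; lra.
rewrite rpow_pos; last lra.
rewrite Rpower_mult Rinv_r // Rpower_1 //; lra.
Qed.

Lemma rpowVK t p : p <> 0 -> 0 <= t -> rpow (rpow t (/ p)) p = t.
Proof.
move=> hp ht; have := rpowK t (/ p) (Rinv_neq_0_compat _ hp) ht.
by rewrite Rinv_inv.
Qed.

Lemma ln_le_sub1 x : 0 < x -> ln x <= x - 1.
Proof.
move=> hx; have := exp_ineq1_le (ln x); rewrite exp_ln //; lra.
Qed.

Lemma rpow_bernoulli u p : 1 <= p -> 0 <= u -> 1 + p * (u - 1) <= rpow u p.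
Proof.
move=> hp hu; case: (Req_dec u 0) => [->|hu']; first by rewrite rpow0; lra.
have {}hu : 0 < u by lra.
case: (Rle_dec (1 + p * (u - 1)) 0) => hw.
  have := rpow_ge0 u p; lra.
set w := 1 + p * (u - 1) in hw *.
have w0 : 0 < w by lra.
rewrite rpow_pos // /Rpower -{1}(exp_ln w) //.
have h1 := ln_le_sub1 (w / u) (Rdiv_lt_0_compat _ _ w0 hu).
have h2 := ln_le_sub1 (1 / u) (Rdiv_lt_0_compat _ _ Rlt_0_1 hu).
rewrite ln_div // in h1; rewrite ln_div ?ln_1 // in h2; try lra.
have e : (w / u - 1) + (p - 1) * (1 / u - 1) = 0.
  rewrite /w; field; lra.
have h3 := Rmult_le_compat_l (p - 1) _ _ ltac:(lra) h2.
have h : ln w <= p * ln u by nra.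
case: h => [h|->]; [left; exact: exp_increasing | right; reflexivity].
Qed.

Lemma rpow_convex t a b p : 1 <= p -> 0 <= t <= 1 -> 0 <= a -> 0 <= b ->
  rpow (t * a + (1 - t) * b) p <= t * rpow a p + (1 - t) * rpow b p.
Proof.
move=> hp ht ha hb; set m := t * a + (1 - t) * b.
have m0 : 0 <= m by rewrite /m; nra.
have ga := rpow_ge0 a p; have gb := rpow_ge0 b p.
case: (Req_dec m 0) => hm; first by rewrite hm rpow0; nra.
have {hm}m0 : 0 < m by lra.
have tang c : 0 <= c -> rpow m p * (1 + p * (c / m - 1)) <= rpow c p.
  move=> hc.
  have hcm : 0 <= c / m.
    by apply: Rmult_le_pos => //; apply: Rlt_le; exact: Rinv_0_lt_compat.
  have -> : rpow c p = rpow m p * rpow (c / m) p.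
    rewrite -rpowM //; try lra.
    by congr rpow; field; lra.
  apply: Rmult_le_compat_l; first exact: rpow_ge0.
  exact: rpow_bernoulli.
have h1 := Rmult_le_compat_l t _ _ ltac:(lra) (tang a ha).
have h2 := Rmult_le_compat_l (1 - t) _ _ ltac:(lra) (tang b hb).
have e : t * (rpow m p * (1 + p * (a / m - 1))) +
  (1 - t) * (rpow m p * (1 + p * (b / m - 1))) = rpow m p.
  have -> : t * (rpow m p * (1 + p * (a / m - 1))) +
    (1 - t) * (rpow m p * (1 + p * (b / m - 1))) =
    rpow m p * (1 + p * ((t * a + (1 - t) * b) / m - 1)) by field; lra.
  rewrite -/m; field; lra.
lra.
Qed.

Variant seq_space : Type :=
  | lp (p : R) (p_ge1 : 1 <= p)
  | c0.

(** Sequences are indexed from [0] instead of [1]: the entry [x k] stands for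
    the mathematical [x_(k+1)]. *)
Definition in_space {K : AbsRing} (X : seq_space) (x : nat -> K) : Prop :=
  match X with
  | lp p _ => ex_series (fun k => rpow (abs (x k)) p)
  | c0 => is_lim_seq (fun k => abs (x k)) 0
  end.

Definition seq_norm {K : AbsRing} (X : seq_space) (x : nat -> K) : R :=
  match X with
  | lp p _ => rpow (Series (fun k => rpow (abs (x k)) p)) (/ p)
  | c0 => real (Sup_seq (fun k => Finite (abs (x k))))
  end.

Record seqs (K : AbsRing) (X : seq_space) : Type := Seqs {
  seqs_val :> nat -> K;
  seqsP : in_space X seqs_val
}.
Arguments Seqs {K X} seqs_val seqsP.
Arguments seqs_val {K X} s k.
Arguments seqsP {K X} s.

(** [seq_norm X x <= c] holds iff [sect_le X n] bounds the sequence of moduli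
    of [x] by [c] for every [n] (see [seq_norm_leP]). *)
Definition sect_le (X : seq_space) (n : nat) (u : nat -> R) (c : R) : Prop :=
  match X with
  | lp p _ => sum_n (fun k => rpow (u k) p) n <= rpow c p
  | c0 => u n <= c
  end.

Lemma sum_n_ge0 (u : nat -> R) n : (forall k, 0 <= u k) -> 0 <= sum_n u n.
Proof.
move=> h; elim: n => [|n IH]; first by rewrite sum_O.
rewrite sum_Sn /plus /=; have := h (S n); lra.
Qed.

Lemma sum_n_le_loc (u v : nat -> R) n :
  (forall k, (k <= n)%nat -> u k <= v k) -> sum_n u n <= sum_n v n.
Proof.
elim: n => [|n IH] h; first by rewrite !sum_O; apply: h.
rewrite !sum_Sn /plus /=; have := h (S n) (Nat.le_refl _).
have := IH (fun k hk => h k (Nat.le_trans _ _ _ hk (Nat.le_succ_diag_r n))); lra.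
Qed.

Lemma sect_leP p hp n u c : 0 <= c ->
  sect_le (lp p hp) n u c <-> rpow (sum_n (fun k => rpow (u k) p) n) (/ p) <= c.
Proof.
move=> hc /=.
have s0 : 0 <= sum_n (fun k => rpow (u k) p) n.
  apply: sum_n_ge0 => k; exact: rpow_ge0.
split=> h.
  rewrite -(rpowK c p) //; last lra.
  apply: rpow_le; last by split.
  apply: Rlt_le; apply: Rinv_0_lt_compat; lra.
rewrite -(rpowVK (sum_n _ n) p) //; last lra.
apply: rpow_le; first lra.
split=> //; exact: rpow_ge0.
Qed.

Lemma sect_le_mono X n u c d : 0 <= c <= d -> sect_le X n u c -> sect_le X n u d.
Proof.
case: X => [p hp|] /= h1 h2; last lra.
apply: Rle_trans h2 _; apply: rpow_le => //; lra.
Qed.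

Lemma sect_le_lim X n u c : 0 <= c ->
  (forall d, c < d -> sect_le X n u d) -> sect_le X n u c.
Proof.
case: X => [p hp|] hc h.
  apply/sect_leP => //; apply: le_epsilon => e he.
  apply/(sect_leP p hp) => //; [lra | apply: h; lra].
apply: le_epsilon => e he; apply: h; lra.
Qed.

Lemma sect_le_triangle X n (u v w : nat -> R) a b :
  (forall k, 0 <= u k) -> (forall k, 0 <= v k) ->
  (forall k, 0 <= w k <= u k + v k) -> 0 <= a -> 0 <= b ->
  sect_le X n u a -> sect_le X n v b -> sect_le X n w (a + b).
Proof.
move=> u0 v0 hw a0 b0 ha hb; apply: sect_le_lim; first lra.
move=> d hd.
have : exists A B, a < A /\ b < B /\ A + B = d.
  exists (a + (d - (a + b)) / 2), (b + (d - (a + b)) / 2); lra.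
case=> A [B [hA [hB <-]]].
have {}ha : sect_le X n u A by apply: sect_le_mono ha; lra.
have {}hb : sect_le X n v B by apply: sect_le_mono hb; lra.
have A0 : 0 < A by lra.
have B0 : 0 < B by lra.
case: X ha hb => [p hp|] /= ha hb; last by have := hw n; lra.
set T := A / (A + B).
have hT : 0 <= T <= 1.
  rewrite /T; split; first by apply: Rlt_le; apply: Rdiv_lt_0_compat; lra.
  apply: (Rmult_le_reg_r (A + B)); first lra.
  rewrite /Rdiv Rmult_assoc Rinv_l; lra.
have PA := rpow_gt0 A p A0; have PB := rpow_gt0 B p B0.
set cu := rpow (A + B) p * T / rpow A p.
set cv := rpow (A + B) p * (1 - T) / rpow B p.
have P0 := rpow_ge0 (A + B) p.
have cu0 : 0 <= cu.
  rewrite /cu; apply: Rmult_le_pos; first nra.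
  apply: Rlt_le; exact: Rinv_0_lt_compat.
have cv0 : 0 <= cv.
  rewrite /cv; apply: Rmult_le_pos; first nra.
  apply: Rlt_le; exact: Rinv_0_lt_compat.
have q c C : 0 <= c -> 0 < C -> 0 <= c / C /\ rpow (c / C) p = rpow c p / rpow C p.
  move=> hc hC; have h : 0 <= c / C.
    apply: Rmult_le_pos => //; apply: Rlt_le; exact: Rinv_0_lt_compat.
  split=> //.
  have e : rpow c p = rpow C p * rpow (c / C) p.
    rewrite -rpowM //; try lra.
    congr rpow; field; lra.
  rewrite e; field; have := rpow_gt0 C p hC; lra.
have key k : rpow (w k) p <= cu * rpow (u k) p + cv * rpow (v k) p.
  apply: (Rle_trans _ (rpow (u k + v k) p)).
    apply: rpow_le; [lra | exact: hw].
  have [qu eu] := q _ _ (u0 k) A0; have [qv ev] := q _ _ (v0 k) B0.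
  have e : u k + v k = (A + B) * (T * (u k / A) + (1 - T) * (v k / B)).
    rewrite /T; field; lra.
  have e0 : 0 <= T * (u k / A) + (1 - T) * (v k / B) by nra.
  rewrite e rpowM //; last lra.
  have hc := rpow_convex T (u k / A) (v k / B) p hp hT qu qv.
  apply: Rle_trans; first by apply: Rmult_le_compat_l hc.
  rewrite eu ev /cu /cv; right; field; lra.
apply: (Rle_trans _ (sum_n (fun k => plus (cu * rpow (u k) p) (cv * rpow (v k) p)) n)).
  by apply: sum_n_le_loc => k _; apply: key.
rewrite sum_n_plus /plus /=.
have -> : sum_n (fun k => cu * rpow (u k) p) n = cu * sum_n (fun k => rpow (u k) p) n.
  exact: (sum_n_mult_l (K := R_AbsRing) cu).
have -> : sum_n (fun k => cv * rpow (v k) p) n = cv * sum_n (fun k => rpow (v k) p) n.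
  exact: (sum_n_mult_l (K := R_AbsRing) cv).
have h1 := Rmult_le_compat_l _ _ _ cu0 ha.
have h2 := Rmult_le_compat_l _ _ _ cv0 hb.
have e1 : cu * rpow A p = rpow (A + B) p * T by rewrite /cu; field; lra.
have e2 : cv * rpow B p = rpow (A + B) p * (1 - T) by rewrite /cv; field; lra.
nra.
Qed.

Lemma sect_le_scal X n (u w : nat -> R) a c :
  (forall k, 0 <= u k) -> (forall k, 0 <= w k <= a * u k) -> 0 <= a -> 0 <= c ->
  sect_le X n u c -> sect_le X n w (a * c).
Proof.
move=> u0 hw a0 c0'; case: X => [p hp|] /= h; last first.
  have := hw n; have := Rmult_le_compat_l a _ _ a0 h; lra.
apply: (Rle_trans _ (sum_n (fun k => rpow a p * rpow (u k) p) n)).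
  apply: sum_n_le_loc => k _; rewrite -rpowM //; apply: rpow_le; [lra | exact: hw].
have -> : sum_n (fun k => rpow a p * rpow (u k) p) n =
  rpow a p * sum_n (fun k => rpow (u k) p) n.
  exact: (sum_n_mult_l (K := R_AbsRing) (rpow a p)).
rewrite rpowM //; apply: Rmult_le_compat_l => //; exact: rpow_ge0.
Qed.

Lemma sect_le_small X n (u : nat -> R) d : 0 <= d ->
  (forall k, 0 <= u k) ->
  (forall k, (k <= n)%nat -> u k <= d) -> sect_le X n u (INR (S n) * d).
Proof.
move=> d0 u0 h; have N1 : 1 <= INR (S n) by apply: (le_INR 1); lia.
case: X => [p hp|] /=; last by have := h n (Nat.le_refl _); rewrite -/(INR (S n)); nra.
rewrite -/(INR (S n)).
apply: (Rle_trans _ (sum_n (fun k => rpow d p) n)).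
  by apply: sum_n_le_loc => k hk; apply: rpow_le; [lra | split => //; exact: h].
rewrite sum_n_const rpowM //; last lra.
apply: Rmult_le_compat_r; first exact: rpow_ge0.
have := rpow_bernoulli (INR (S n)) p hp ltac:(lra); nra.
Qed.

Section SeqNorm.
Context {K : AbsRing}.
Variable X : seq_space.
Implicit Types x y : nat -> K.

Let mod_ x : nat -> R := fun k => abs (x k).

Lemma abs_seq_ge0 x k : 0 <= mod_ x k.
Proof. exact: abs_ge_0. Qed.

Lemma seq_norm_ge0 x : 0 <= seq_norm X x.
Proof.
case: X => [p hp|] /=; first exact: rpow_ge0.
have := Sup_seq_correct (fun k => Finite (abs (x k))).
case: (Sup_seq _) => [r||] /= h; try lra.
apply: le_epsilon => e he; have := proj1 (h (mkposreal e he)) O => /= h0.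
have := abs_ge_0 (x O); lra.
Qed.

Lemma is_lim_seq0_bounded (u : nat -> R) : is_lim_seq u 0 -> exists M, forall n, u n <= M.
Proof.
move/is_lim_seq_Reals => h.
have [M hM] := cauchy_bound u (CV_Cauchy u (exist _ 0 h)).
by exists M => n; apply: hM; exists n.
Qed.

Lemma seq_norm_leP x c : in_space X x -> 0 <= c ->
  (seq_norm X x <= c <-> forall n, sect_le X n (mod_ x) c).
Proof.
move=> hx hc; case: X hx => [p hp|] /= hx.
- have hs : is_series (fun k => rpow (abs (x k)) p) (Series (fun k => rpow (abs (x k)) p)).
    exact: Series_correct.
  have hpart n : sum_n (fun k => rpow (abs (x k)) p) n <= Series (fun k => rpow (abs (x k)) p).
    apply: (is_lim_seq_incr_compare (sum_n (fun k => rpow (abs (x k)) p))).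
      exact: hs.
    move=> m; rewrite sum_Sn /plus /=; have := rpow_ge0 (abs (x (S m))) p; lra.
  have S0 : 0 <= Series (fun k => rpow (abs (x k)) p).
    apply: Rle_trans (hpart O); apply: sum_n_ge0 => k; exact: rpow_ge0.
  split=> h.
    move=> n; apply: Rle_trans (hpart n) _.
    rewrite -(rpowVK (Series _) p) //; last lra.
    apply: rpow_le; first lra.
    split=> //; exact: rpow_ge0.
  rewrite -(rpowK c p) //; last lra.
  apply: rpow_le; first by apply: Rlt_le; apply: Rinv_0_lt_compat; lra.
  split=> //.
  apply: (is_lim_seq_le (sum_n (fun k => rpow (abs (x k)) p)) (fun _ => rpow c p)
    (Series (fun k => rpow (abs (x k)) p)) (rpow c p)) => //.
  exact: is_lim_seq_const.
- have [M hM] := is_lim_seq0_bounded _ hx.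
  have := Sup_seq_correct (fun k => Finite (abs (x k))).
  case: (Sup_seq _) => [r||] /= hr.
  + split=> h.
      move=> n; apply: le_epsilon => e he.
      have := proj1 (hr (mkposreal e he)) n => /= h0; rewrite /mod_; lra.
    apply: le_epsilon => e he.
    have [_ [n hn]] := hr (mkposreal e he); have := h n; rewrite /= /mod_ in hn *; lra.
  + have [n hn] := hr M; have := hM n; lra.
  + by have := hr (abs (x O)) O; lra.
Qed.

Lemma in_space_bound x : in_space X x -> forall n, sect_le X n (mod_ x) (seq_norm X x).
Proof.
move=> hx; apply/seq_norm_leP => //; [exact: seq_norm_ge0 | lra].
Qed.

Lemma in_lp_of_bound p hp x c :
  (forall n, sect_le (lp p hp) n (mod_ x) c) -> in_space (lp p hp) x.
Proof.
move=> h /=.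
have [l hl] : ex_finite_lim_seq (sum_n (fun k => rpow (abs (x k)) p)).
  apply: (ex_finite_lim_seq_incr _ (rpow c p)) => n; last exact: (h n).
  rewrite sum_Sn /plus /=; have := rpow_ge0 (abs (x (S n))) p; lra.
by exists l.
Qed.

Lemma in_space_plus x y : in_space X x -> in_space X y ->
  in_space X (fun k => plus (x k) (y k)).
Proof.
move=> hx hy.
have bx := in_space_bound x hx; have by' := in_space_bound y hy.
have nx := seq_norm_ge0 x; have ny := seq_norm_ge0 y.
have ht n := sect_le_triangle X n _ _ (mod_ (fun k => plus (x k) (y k))) _ _
  (abs_seq_ge0 x) (abs_seq_ge0 y)
  (fun k => conj (abs_ge_0 _) (abs_triangle _ _)) nx ny (bx n) (by' n).
case: X hx hy ht => [p hp|] hx hy ht; first exact: in_lp_of_bound ht.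
rewrite /= in hx hy *.
apply: (is_lim_seq_le_le (fun _ => 0) _ (fun k => abs (x k) + abs (y k))).
- move=> k; split; [exact: abs_ge_0 | exact: abs_triangle].
- exact: is_lim_seq_const.
- have -> : Finite 0 = Finite (0 + 0) by rewrite Rplus_0_r.
  exact: is_lim_seq_plus'.
Qed.

Lemma in_space_scal (a : K) x : in_space X x -> in_space X (fun k => mult a (x k)).
Proof.
move=> hx.
have bx := in_space_bound x hx.
have ht n := sect_le_scal X n _ (mod_ (fun k => mult a (x k))) _ _
  (abs_seq_ge0 x) (fun k => conj (abs_ge_0 _) (abs_mult _ _)) (abs_ge_0 a)
  (seq_norm_ge0 x) (bx n).
case: X hx ht => [p hp|] hx ht; first exact: in_lp_of_bound ht.
rewrite /= in hx *.
apply: (is_lim_seq_le_le (fun _ => 0) _ (fun k => abs a * abs (x k))).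
- move=> k; split; [exact: abs_ge_0 | exact: abs_mult].
- exact: is_lim_seq_const.
- have -> : Finite 0 = Finite (abs a * 0) by rewrite Rmult_0_r.
  exact: (is_lim_seq_scal_l (fun k => abs (x k)) (abs a) 0).
Qed.

Lemma in_space_zero : in_space X (fun _ => zero : K).
Proof.
case: X => [p hp|] /=; rewrite abs_zero ?rpow0; last exact: is_lim_seq_const.
exists 0; apply: is_lim_seq_ext (is_lim_seq_const 0) => n.
by rewrite sum_n_const Rmult_0_r.
Qed.

Lemma in_space_opp x : in_space X x -> in_space X (fun k => opp (x k)).
Proof.
case: X => [p hp|] /= h.
  by apply: ex_series_ext h => k; rewrite abs_opp.
by apply: is_lim_seq_ext h => k; rewrite abs_opp.
Qed.

Lemma seq_norm_triangle x y : in_space X x -> in_space X y ->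
  seq_norm X (fun k => plus (x k) (y k)) <= seq_norm X x + seq_norm X y.
Proof.
move=> hx hy; have nx := seq_norm_ge0 x; have ny := seq_norm_ge0 y.
apply/seq_norm_leP; [exact: in_space_plus | lra | move=> n].
apply: (sect_le_triangle X n (mod_ x) (mod_ y)) => //.
- exact: abs_seq_ge0.
- exact: abs_seq_ge0.
- move=> k; split; [exact: abs_ge_0 | exact: abs_triangle].
- exact: in_space_bound.
- exact: in_space_bound.
Qed.

Lemma seq_norm_scal (a : K) x : in_space X x ->
  seq_norm X (fun k => mult a (x k)) <= abs a * seq_norm X x.
Proof.
move=> hx; have nx := seq_norm_ge0 x; have na := abs_ge_0 a.
apply/seq_norm_leP; [exact: in_space_scal | exact: Rmult_le_pos | move=> n].
apply: (sect_le_scal X n (mod_ x)) => //.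
- exact: abs_seq_ge0.
- move=> k; split; [exact: abs_ge_0 | exact: abs_mult].
- exact: in_space_bound.
Qed.

Lemma coord_le_norm x k : in_space X x -> abs (x k) <= seq_norm X x.
Proof.
move=> hx; have := in_space_bound x hx k; have nx := seq_norm_ge0 x.
case: X hx nx => [p hp|] hx nx // h.
rewrite -(rpowK (abs (x k)) p); [| lra | exact: abs_ge_0].
rewrite -(rpowK (seq_norm (lp p hp) x) p); [| lra | exact: nx].
apply: rpow_le; first by apply: Rlt_le; apply: Rinv_0_lt_compat; lra.
split; first exact: rpow_ge0.
apply: Rle_trans h; rewrite /mod_; case: k => [|k]; first by rewrite sum_O; lra.
rewrite sum_Sn /plus /=.
have := sum_n_ge0 (fun k => rpow (abs (x k)) p) k (fun k => rpow_ge0 _ _); lra.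
Qed.

End SeqNorm.

Section SeqStructures.
Context {K : AbsRing} {X : seq_space}.
Implicit Types x y z : seqs K X.

Lemma seqs_eq x y : (forall k, x k = y k) -> x = y.
Proof.
case: x => x hx; case: y => y hy /= h.
have e : x = y by apply: functional_extensionality.
subst y; congr Seqs; exact: proof_irrelevance.
Qed.

Definition seqs_plus x y : seqs K X :=
  Seqs _ (in_space_plus X x y (seqsP x) (seqsP y)).
Definition seqs_zero : seqs K X := Seqs _ (in_space_zero X).
Definition seqs_opp x : seqs K X := Seqs _ (in_space_opp X x (seqsP x)).
Definition seqs_scal (a : K) x : seqs K X := Seqs _ (in_space_scal X a x (seqsP x)).

Lemma seqs_plusC x y : seqs_plus x y = seqs_plus y x.
Proof. apply: seqs_eq => k; exact: plus_comm. Qed.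
Lemma seqs_plusA x y z : seqs_plus x (seqs_plus y z) = seqs_plus (seqs_plus x y) z.
Proof. apply: seqs_eq => k; exact: plus_assoc. Qed.
Lemma seqs_plus0 x : seqs_plus x seqs_zero = x.
Proof. apply: seqs_eq => k; exact: plus_zero_r. Qed.
Lemma seqs_plusN x : seqs_plus x (seqs_opp x) = seqs_zero.
Proof. apply: seqs_eq => k; exact: plus_opp_r. Qed.

Definition seqs_AbelianMonoid_mixin :=
  AbelianMonoid.Mixin (seqs K X) seqs_plus seqs_zero seqs_plusC seqs_plusA seqs_plus0.
Canonical seqs_AbelianMonoid :=
  AbelianMonoid.Pack (seqs K X) seqs_AbelianMonoid_mixin (seqs K X).

Definition seqs_AbelianGroup_mixin :=
  AbelianGroup.Mixin seqs_AbelianMonoid seqs_opp seqs_plusN.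
Canonical seqs_AbelianGroup :=
  AbelianGroup.Pack (seqs K X)
    (AbelianGroup.Class _ seqs_AbelianMonoid_mixin seqs_AbelianGroup_mixin) (seqs K X).

Lemma seqs_scalA (a b : K) x : seqs_scal a (seqs_scal b x) = seqs_scal (mult a b) x.
Proof. apply: seqs_eq => k; exact: mult_assoc. Qed.
Lemma seqs_scal1 x : seqs_scal one x = x.
Proof. apply: seqs_eq => k; exact: mult_one_l. Qed.
Lemma seqs_scalDr (a : K) x y :
  seqs_scal a (plus x y) = plus (seqs_scal a x) (seqs_scal a y).
Proof. apply: seqs_eq => k; exact: mult_distr_l. Qed.
Lemma seqs_scalDl (a b : K) x :
  seqs_scal (plus a b) x = plus (seqs_scal a x) (seqs_scal b x).
Proof. apply: seqs_eq => k; exact: mult_distr_r. Qed.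

Definition seqs_ModuleSpace_mixin :=
  ModuleSpace.Mixin K seqs_AbelianGroup seqs_scal seqs_scalA seqs_scal1
    seqs_scalDr seqs_scalDl.
Canonical seqs_ModuleSpace :=
  ModuleSpace.Pack K (seqs K X)
    (ModuleSpace.Class _ _ (AbelianGroup.class seqs_AbelianGroup)
       seqs_ModuleSpace_mixin) (seqs K X).

Definition seqs_norm x : R := seq_norm X x.

Definition seqs_ball x (eps : R) y : Prop := seqs_norm (minus y x) < eps.

Lemma seqs_norm_triangle x y : seqs_norm (plus x y) <= seqs_norm x + seqs_norm y.
Proof. exact: seq_norm_triangle (seqsP x) (seqsP y). Qed.

Lemma seqs_norm_scal (a : K) x : seqs_norm (scal a x) <= abs a * seqs_norm x.
Proof. exact: seq_norm_scal (seqsP x). Qed.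

Lemma seqs_norm_eq0 x : seqs_norm x = 0 -> x = zero.
Proof.
move=> h; apply: seqs_eq => k; apply: abs_eq_zero.
have := coord_le_norm X x k (seqsP x); rewrite -/(seqs_norm x) h.
have := abs_ge_0 (x k); lra.
Qed.

Lemma seqs_norm0 : seqs_norm zero = 0.
Proof.
have := seqs_norm_scal zero zero; rewrite abs_zero Rmult_0_l scal_zero_l.
by move=> h; apply: Rle_antisym h _; exact: seq_norm_ge0.
Qed.

Lemma seqs_norm_opp x : seqs_norm (opp x) = seqs_norm x.
Proof.
have h y : seqs_norm (opp y) <= seqs_norm y.
  have := seqs_norm_scal (opp one) y; rewrite abs_opp_one Rmult_1_l.
  by rewrite scal_opp_one.
have := h x; have := h (opp x); rewrite opp_opp; lra.
Qed.

Lemma seqs_ball_center x (e : posreal) : seqs_ball x e x.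
Proof. rewrite /seqs_ball minus_eq_zero seqs_norm0; exact: cond_pos. Qed.

Lemma seqs_ball_sym x y (e : R) : seqs_ball x e y -> seqs_ball y e x.
Proof. by rewrite /seqs_ball -seqs_norm_opp opp_minus. Qed.

Lemma seqs_ball_triangle x y z (e1 e2 : R) :
  seqs_ball x e1 y -> seqs_ball y e2 z -> seqs_ball x (e1 + e2) z.
Proof.
rewrite /seqs_ball (minus_trans y z x) => h1 h2.
apply: Rle_lt_trans (seqs_norm_triangle _ _) _; rewrite Rplus_comm.
exact: Rplus_lt_compat.
Qed.

Definition seqs_UniformSpace_mixin :=
  UniformSpace.Mixin (seqs K X) seqs_zero seqs_ball seqs_ball_center
    seqs_ball_sym seqs_ball_triangle.
Canonical seqs_UniformSpace :=
  UniformSpace.Pack (seqs K X) seqs_UniformSpace_mixin (seqs K X).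

Canonical seqs_NormedModuleAux :=
  NormedModuleAux.Pack K (seqs K X)
    (NormedModuleAux.Class K _ (ModuleSpace.class K seqs_ModuleSpace)
       seqs_UniformSpace_mixin) (seqs K X).

Lemma seqs_norm_ball1 x y (eps : R) : seqs_norm (minus y x) < eps -> ball x eps y.
Proof. by []. Qed.

Lemma seqs_norm_ball2 x y (eps : posreal) :
  ball x eps y -> seqs_norm (minus y x) < 1 * eps.
Proof. by rewrite Rmult_1_l. Qed.

Definition seqs_NormedModule_mixin :=
  NormedModule.Mixin K seqs_NormedModuleAux seqs_norm 1 seqs_norm_triangle
    seqs_norm_scal seqs_norm_ball1 seqs_norm_ball2 seqs_norm_eq0.
Canonical seqs_NormedModule :=
  NormedModule.Pack K (seqs K X)
    (NormedModule.Class K _ (NormedModuleAux.class K seqs_NormedModuleAux)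
       seqs_NormedModule_mixin) (seqs K X).

End SeqStructures.

Definition abs_complete (K : AbsRing) : Prop :=
  forall F : (K -> Prop) -> Prop, ProperFilter F ->
    (forall eps : posreal, exists l : K, F (fun z => abs (minus z l) < eps)) ->
    exists l : K, forall eps : posreal, F (fun z => abs (minus z l) < eps).

Lemma seqs_cauchy_lim {K : AbsRing} {X : seq_space} :
  abs_complete K ->
  forall F : (seqs K X -> Prop) -> Prop, ProperFilter F -> cauchy F ->
  exists l : seqs K X, forall eps : posreal, F (ball l eps).
Proof.
move=> hK F PF hF.
have hcoord k : exists l : K, forall eps : posreal, F (fun x => abs (minus (x k) l) < eps).
  have PFk : ProperFilter (filtermap (fun x : seqs K X => x k) F).
    exact: filtermap_proper_filter.
  have [|l hl] := hK _ PFk; last by exists l.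
  move=> eps; have [x hx] := hF eps; exists (x k); rewrite /filtermap.
  apply: filter_imp hx => y hy.
  have h : seqs_norm (minus y x) < eps := hy.
  apply: Rle_lt_trans h; rewrite /seqs_norm.
  exact: (coord_le_norm X _ k (seqsP (minus y x))).
pose L k := proj1_sig (constructive_indefinite_description _ (hcoord k)).
have hL k : forall eps : posreal, F (fun x => abs (minus (x k) (L k)) < eps).
  exact: (proj2_sig (constructive_indefinite_description _ (hcoord k))).
have hLn n (d : posreal) : F (fun x => forall k, (k <= n)%nat -> abs (minus (x k) (L k)) < d).
  elim: n => [|n IH].
    apply: filter_imp (hL O d) => x hx k hk; by have -> : k = O by lia.
  apply: filter_imp (filter_and _ _ IH (hL (S n) d)) => x [h1 h2] k hk.
  case: (Nat.eq_dec k (S n)) => [->//|hne]; apply: h1; lia.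
have close_ (x0 : seqs K X) (eps : posreal) : F (ball x0 eps) ->
  forall n, sect_le X n (fun k => abs (minus (L k) (x0 k))) eps.
  move=> h n; apply: sect_le_lim; first by have := cond_pos eps; lra.
  move=> d hd; have N0 : 0 < INR (S n) by apply: lt_0_INR; lia.
  have hdel : 0 < (d - eps) / INR (S n) by apply: Rdiv_lt_0_compat; lra.
  have [y [h1 h2]] := filter_ex _ (filter_and _ _ h (hLn n (mkposreal _ hdel))).
  have -> : d = eps + INR (S n) * ((d - eps) / INR (S n)) by field; lra.
  apply: (sect_le_triangle X n (fun k => abs (minus (y k) (x0 k)))
    (fun k => abs (minus (y k) (L k)))).
  - move=> k; exact: abs_ge_0.
  - move=> k; exact: abs_ge_0.
  - move=> k; split; first exact: abs_ge_0.
    rewrite (minus_trans (y k) (L k) (x0 k)) -(abs_minus (L k)) Rplus_comm.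
    exact: abs_triangle.
  - by have := cond_pos eps; lra.
  - by apply: Rmult_le_pos; lra.
  - apply: (sect_le_mono X n _ (seqs_norm (minus y x0))).
      split; [exact: seq_norm_ge0 | exact: Rlt_le].
    exact: (in_space_bound X (minus y x0) (seqsP _) n).
  - apply: sect_le_small; first lra.
      move=> k; exact: abs_ge_0.
    move=> k hk; apply: Rlt_le; exact: (h2 k hk).
have LX : in_space X L.
  case: X F PF hF hcoord L hL hLn close_ => [p hp|] F PF hF hcoord L hL hLn close_.
    have [x0 hx0] := hF (mkposreal 1 Rlt_0_1).
    have h : in_space (lp p hp) (fun k => minus (L k) (x0 k)).
      exact: in_lp_of_bound (close_ _ _ hx0).
    have -> : L = (fun k => plus (minus (L k) (x0 k)) (x0 k)).
      apply: functional_extensionality => k.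
      by rewrite /minus -plus_assoc plus_opp_l plus_zero_r.
    apply: in_space_plus => //; exact: seqsP.
  apply/is_lim_seq_spec => eps.
  have he : 0 < eps / 2 by have := cond_pos eps; lra.
  have [x0 hx0] := hF (mkposreal _ he).
  have := seqsP x0; move/is_lim_seq_spec => /(_ (mkposreal _ he)) [N hN].
  exists N => n hn; have := hN n hn; have := close_ _ _ hx0 n => /=.
  rewrite !Rminus_0_r !Rabs_pos_eq; try exact: abs_ge_0.
  move=> h1 h2; have := abs_triangle (minus (L n) (x0 n)) (x0 n).
  rewrite /minus -plus_assoc plus_opp_l plus_zero_r; rewrite /minus in h1; lra.
exists (Seqs L LX) => eps.
have he : 0 < eps / 3 by have := cond_pos eps; lra.
have [x0 hx0] := hF (mkposreal _ he).
apply: filter_imp (hx0) => y hy.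
have h : seqs_norm (minus (Seqs L LX) x0) <= eps / 3.
  apply/seq_norm_leP; [exact: seqsP | lra | exact: (close_ _ _ hx0)].
have h2 : ball (Seqs L LX) (eps * 2 / 3) x0.
  apply: ball_sym; rewrite /ball /= /seqs_ball; lra.
have -> : pos eps = eps * 2 / 3 + eps / 3 by field.
exact: ball_triangle h2 hy.
Qed.

Variant ground_field : Type := RealField | ComplexField.

Definition scalars (F : ground_field) : AbsRing :=
  match F with
  | RealField => R_AbsRing
  | ComplexField => C_AbsRing
  end.

Lemma scalars_complete F : abs_complete (scalars F).
Proof.
case: F => G PG hG.
  exists (lim (T := R_CompleteSpace) G) => eps.
  exact: (complete_cauchy (T := R_CompleteSpace) G PG hG eps).
have hc : cauchy (T := C_UniformSpace) G.
  move=> eps; have [l hl] := hG eps; exists l.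
  apply: filter_imp hl => z hz.
  exact: (C_NormedModule_mixin_compat1 l z eps hz).
exists (lim (T := CompleteNormedModule.CompleteSpace _ C_CompleteNormedModule) G) => eps.
have he : 0 < eps / sqrt 2.
  apply: Rdiv_lt_0_compat; [exact: cond_pos | apply: sqrt_lt_R0; lra].
apply: filter_imp (complete_cauchy (T := CompleteNormedModule.CompleteSpace _ C_CompleteNormedModule) G PG hc (mkposreal _ he)).
move=> z hz; have := C_NormedModule_mixin_compat2 _ _ _ hz => /=.
have s0 : 0 < sqrt 2 by apply: sqrt_lt_R0; lra.
have -> : sqrt 2 * (eps / sqrt 2) = eps by field; lra.
by [].
Qed.

Section Banach.
Context {F : ground_field} {X : seq_space}.
Notation E := (seqs (scalars F) X).

Definition seqs_lim (G : (E -> Prop) -> Prop) : E :=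
  epsilon (inhabits (zero : E)) (fun l : E => forall eps : posreal, G (ball l eps)).

Lemma seqs_complete_cauchy (G : (E -> Prop) -> Prop) :
  ProperFilter G -> cauchy G -> forall eps : posreal, G (ball (seqs_lim G) eps).
Proof.
move=> PG hG.
apply: (epsilon_spec (inhabits (zero : E))
  (fun l : E => forall eps : posreal, G (ball l eps))).
exact: (seqs_cauchy_lim (scalars_complete F) G PG hG).
Qed.

Lemma seqs_close_lim (G1 G2 : (E -> Prop) -> Prop) :
  filter_le G1 G2 -> filter_le G2 G1 -> close (seqs_lim G1) (seqs_lim G2).
Proof.
move=> h1 h2; have -> : G1 = G2.
  apply: functional_extensionality => P; apply: propositional_extensionality.
  by split; [apply: h2 | apply: h1].
move=> eps; exact: ball_center.
Qed.

Definition seqs_CompleteSpace_mixin :=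
  CompleteSpace.Mixin (@seqs_UniformSpace (scalars F) X) seqs_lim
    seqs_complete_cauchy seqs_close_lim.
Canonical seqs_CompleteSpace :=
  CompleteSpace.Pack E
    (CompleteSpace.Class _ seqs_UniformSpace_mixin seqs_CompleteSpace_mixin) E.
Canonical seqs_CompleteNormedModule :=
  CompleteNormedModule.Pack (scalars F) E
    (CompleteNormedModule.Class (scalars F) _
       (NormedModule.class (scalars F) seqs_NormedModule)
       seqs_CompleteSpace_mixin) E.

End Banach.

Section Shift.
Context {F : ground_field} (X : seq_space) (lambda : scalars F).

(** [(lambda^k x_(k+1))_(k >= 1)] in [0]-based indexing. *)
Definition shift_seq (x : nat -> scalars F) : nat -> scalars F :=
  fun k => mult (pow_n lambda (S k)) (x (S k)).

(** The value [zero] outside the domain is irrelevant. *)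
Definition shift_app (x : seqs (scalars F) X) : seqs (scalars F) X :=
  match excluded_middle_informative (in_space X (shift_seq x)) with
  | left h => Seqs (shift_seq x) h
  | right _ => zero
  end.

Definition weighted_shift : operator (@seqs_CompleteNormedModule F X) :=
  Operator
    (fun x : seqs (scalars F) X => in_space X (shift_seq x)) shift_app.

Lemma weighted_shiftE (x : seqs (scalars F) X) (k : nat) : dom weighted_shift x ->
  (app weighted_shift x : seqs (scalars F) X) k = mult (pow_n lambda (S k)) (x (S k)).
Proof.
by rewrite /= /shift_app => h; case: excluded_middle_informative.
Qed.

End Shift.

(* Main.v *)
Require Import Defs.
From Stdlib Require Import Reals.
From Coquelicot Require Import Coquelicot.
From Stdlib Require Import ZArith Lra Lia Cantor ssreflect.
From Stdlib Require Import ClassicalEpsilon FunctionalExtensionality.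

(** The weights disappear after a diagonal change of variables. Let
    [mu = 1 / lambda] and write [x k = mu^(1 + ... + k) * u k]. Since
    [lambda^(k+1) * mu^(k+1) = 1], the operator acts on [u] as the plain
    backward shift: the [n]-th iterate of [x] is
    [k |-> mu^(1 + ... + k) * u (k + n)] ([op_pow_unweights]). The factor
    [mu^(1 + ... + k)] decays faster than any geometric sequence, so every [u]
    of at most exponential growth gives a vector of the space at which all
    powers are defined. Everything is then reduced to choosing [u]. All norms are
    estimated by comparison with a geometric sequence ([geometric_seq_norm]),
    which treats the [l_p] spaces and [c_0] at once.

    - Unboundedness: [u k = s^k] gives an eigenvector with eigenvalue [s]. Every
      scalar is thus an eigenvalue, and a bounded operator has bounded
      eigenvalues.

    - Hypercyclicity: take for [u] a sequence with [|u n| <= n] that contains,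
      starting at arbitrarily large positions [n], an approximation of every
      finite word followed by zeros up to position [2 n]
      ([universal_sequence]). Shifting by such an [n] produces the word, plus a
      remainder supported on [k >= n] whose unweighted entries are at most
      [k + n <= 2 k]; the weights make it uniformly small as [n] grows.

    - Periodic points: given a finitely supported target, repeat its unweighted
      coordinates with a large period [P]. The resulting vector is periodic, and
      it differs from the target only at indices [k >= P], by a bounded sequence
      times tiny weights. *)

(** * Scalars *)

(** The rational numbers, enumerated with repetitions. *)
Definition real_code (n : nat) : R :=
  let (a, m) := of_nat n in let (b, c) := of_nat m in
  (INR a - INR b) / INR (S c).

Lemma real_code_dense (t eps : R) : 0 < eps -> exists i, Rabs (real_code i - t) < eps.
Proof.
move=> he; have [c [hc c0]] := archimed_cor1 eps he.
have N0 : 0 < INR c by apply: lt_0_INR.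
pose z := up (t * INR c).
have [z1 z2] := archimed (t * INR c); rewrite -/z in z1 z2.
have [a [b hab]] : exists a b : nat, INR a - INR b = IZR z.
  case: (Z.le_gt_cases 0 z) => hz.
    exists (Z.to_nat z), O; rewrite INR_IZR_INZ Z2Nat.id //=; lra.
  exists O, (Z.to_nat (- z)); rewrite (INR_IZR_INZ (Z.to_nat _)) Z2Nat.id; last lia.
  rewrite opp_IZR /=; lra.
exists (to_nat (a, to_nat (b, pred c))).
rewrite /real_code !cancel_of_to.
have -> : S (pred c) = c by lia.
rewrite hab.
have -> : IZR z / INR c - t = (IZR z - t * INR c) * / INR c by field; lra.
have I0 : 0 < / INR c by apply: Rinv_0_lt_compat.
rewrite Rabs_pos_eq; last by apply: Rmult_le_pos; lra.
nra.
Qed.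

(** Separability of the field is what lets one sequence approximate all finite
    words. *)
Lemma scalars_separable F : exists q : nat -> scalars F,
  forall (t : scalars F) eps, 0 < eps -> exists i, abs (minus (q i) t) < eps.
Proof.
case: F; first by exists real_code => t eps; exact: real_code_dense.
exists (fun n => let (a, b) := of_nat n in (real_code a, real_code b)).
move=> [t1 t2] eps he.
have [a ha] := real_code_dense t1 (eps / 2) ltac:(lra).
have [b hb] := real_code_dense t2 (eps / 2) ltac:(lra).
exists (to_nat (a, b)); rewrite cancel_of_to.
apply: Rle_lt_trans (Cmod_2Rmax _) _ => /=.
have s2 : sqrt 2 < 2.
  rewrite -{2}(sqrt_Rsqr 2); last lra.
  apply: sqrt_lt_1; rewrite /Rsqr; lra.
have s0 := sqrt_pos 2.
have := Rabs_pos (real_code a + - t1).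
have := Rmax_l (Rabs (real_code a + - t1)) (Rabs (real_code b + - t2)).
have : Rmax (Rabs (real_code a + - t1)) (Rabs (real_code b + - t2)) < eps / 2.
  by apply: Rmax_lub_lt.
nra.
Qed.

Lemma scalars_multC F (a b : scalars F) : mult a b = mult b a.
Proof. case: F a b => a b; [exact: Rmult_comm | exact: Cmult_comm]. Qed.

Lemma scalars_inv F (a : scalars F) : 1 < abs a ->
  exists b : scalars F, mult a b = one /\ abs b < 1.
Proof.
have h1 t : 1 < t -> / t < 1 by move=> ht; rewrite -Rinv_1; apply: Rinv_lt_contravar; lra.
case: F a => a ha.
  exists (/ a : R); rewrite /abs /= in ha *; split.
    apply: Rinv_r => h; move: ha; rewrite h Rabs_R0; lra.
  by rewrite Rabs_inv; exact: h1.
have a0 : a <> (RtoC 0) by move=> h; move: ha; rewrite h /abs /= Cmod_0; lra.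
exists (/ a)%C; split; first exact: Cinv_r.
rewrite /abs /= Cmod_inv //; exact: h1.
Qed.

(** * A universal sequence *)

(** [digit c] reads [c] as the stream [c = <digit c 0, <digit c 1, ...>>] of
    nested Cantor pairs. *)
Fixpoint digit (c k : nat) : nat :=
  match k with
  | O => fst (of_nat c)
  | S k' => digit (snd (of_nat c)) k'
  end.

(** The code can be taken arbitrarily large because the tail left after the
    first [d] digits is free and the pairing dominates its components. *)
Lemma digit_surj (f : nat -> nat) d N :
  exists c, (N <= c)%nat /\ forall k, (k < d)%nat -> digit c k = f k.
Proof.
elim: d f => [|d IH] f; first by exists N; split=> // k; lia.
have [c [hN hc]] := IH (fun k => f (S k)).
have := to_nat_non_decreasing (f O) c; have := cancel_of_to (f O, c).
move: (to_nat _) => c' hc' hle; exists c'; split; first lia.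
by case=> [|k] hk /=; rewrite hc' //= hc //; lia.
Qed.

Lemma eventually_all_below (P : nat -> nat -> Prop) d :
  (forall k, exists N, forall n, (N <= n)%nat -> P k n) ->
  exists N, forall n k, (N <= n)%nat -> (k < d)%nat -> P k n.
Proof.
move=> h; elim: d => [|d [N hN]]; first by exists O => n k; lia.
have [N' hN'] := h d; exists (N + N')%nat => n k hn hk.
case: (Nat.eq_dec k d) => [->|hne]; [apply: hN' | apply: hN]; lia.
Qed.

(** Cut the indices into the dyadic blocks [2^j <= m < 2^(j+1)] and write in the
    [j]-th block the word coded by [j], padded with zeros. Entries of modulus
    above [j] are replaced by zero: this keeps [u] below the identity and does no
    harm, as every word has arbitrarily large codes. *)
Lemma universal_sequence F : exists u : nat -> scalars F,
  (forall n, abs (u n) <= INR n) /\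
  forall (v : nat -> scalars F) (delta : nat -> R) (d N : nat),
  (forall k, 0 < delta k) -> exists n, (N <= n)%nat /\
    (forall k, (k < d)%nat -> abs (minus (u (k + n)%nat) (v k)) < delta k) /\
    (forall k, (d <= k < n)%nat -> u (k + n)%nat = zero).
Proof.
have [q hq] := scalars_separable F.
pose word j k : scalars F := let (d, c) := of_nat j in
  if excluded_middle_informative ((k < d)%nat /\ abs (q (digit c k)) <= INR j) is left _
  then q (digit c k) else zero.
pose u n := word (Nat.log2 n) (n - 2 ^ Nat.log2 n)%nat.
have uE j k : (k < 2 ^ j)%nat -> u (k + 2 ^ j)%nat = word j k.
  move=> hk; rewrite /u (Nat.log2_unique _ j); [|lia|rewrite /=; lia].
  congr word; lia.
exists u; split.
  move=> n; apply: (Rle_trans _ (INR (Nat.log2 n))); last first.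
    by apply: le_INR; exact: Nat.log2_le_lin (Nat.le_0_l n).
  rewrite /u /word; case: (of_nat _) => d c.
  case: excluded_middle_informative => [[]//|_]; rewrite abs_zero; exact: pos_INR.
move=> v delta d N hd.
pose f k := proj1_sig (constructive_indefinite_description _ (hq (v k) (delta k) (hd k))).
have hf k : abs (minus (q (f k)) (v k)) < delta k.
  exact: (proj2_sig (constructive_indefinite_description _ (hq (v k) (delta k) (hd k)))).
(* A code so large that none of the letters is cut off. *)
have [k|N' hN'] := eventually_all_below (fun k n => abs (q (f k)) <= INR n) d.
  have [N' hN'] := INR_unbounded (abs (q (f k))).
  by exists N' => n /le_INR; lra.
have [c [hc hdig]] := digit_surj f d (N + N')%nat.
pose j := to_nat (d, c).
have hj : (c + d <= j)%nat by exact: to_nat_non_decreasing.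
have hj2 : (j < 2 ^ j)%nat by apply: Nat.pow_gt_lin_r; lia.
exists (2 ^ j)%nat; split; first lia; split=> k hk.
  rewrite uE; last lia.
  rewrite /word /j cancel_of_to hdig // -/j.
  case: excluded_middle_informative => // -[]; split=> //.
  by apply: hN' => //; lia.
rewrite uE; last lia.
rewrite /word /j cancel_of_to.
case: excluded_middle_informative => [[h _]|//]; lia.
Qed.

(** * Norm estimates *)

Lemma rpow_le_self t p : 1 <= p -> 0 <= t <= 1 -> rpow t p <= t.
Proof.
move=> hp ht; have := rpow_convex t 1 0 p hp ht ltac:(lra) ltac:(lra).
rewrite rpow0 (rpow_pos 1); last lra.
by rewrite /Rpower ln_1 !Rmult_0_r exp_0 !Rplus_0_r !Rmult_1_r.
Qed.

Lemma half_pow_bounds k : 0 < (/ 2) ^ k <= 1.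
Proof.
elim: k => [|k IH] /=; lra.
Qed.

Lemma sum_half_pow n : sum_n (fun k => (/ 2) ^ k) n = 2 - (/ 2) ^ n.
Proof.
elim: n => [|n IH]; first by rewrite sum_O /=; lra.
rewrite sum_Sn IH /plus /=; lra.
Qed.

(** The constant [2] is the sum of the geometric series; for [l_p] it comes from
    [((/ 2)^k)^p <= (/ 2)^k] and [2 <= 2^p]. *)
Lemma geometric_seq_norm {K : AbsRing} (X : seq_space) (x : nat -> K) c :
  (forall k, abs (x k) <= c * (/ 2) ^ k) -> in_space X x /\ seq_norm X x <= 2 * c.
Proof.
move=> h; have c0' : 0 <= c.
  by have := h O; have := abs_ge_0 (x O); rewrite /=; lra.
have hs n : sect_le X n (fun k => abs (x k)) (2 * c).
  case: X => [p hp|] /=; last first.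
    apply: Rle_trans (h n) _; have := half_pow_bounds n; nra.
  apply: (Rle_trans _ (sum_n (fun k => rpow c p * (/ 2) ^ k) n)).
    apply: sum_n_le_loc => k _; have hk := half_pow_bounds k.
    apply: (Rle_trans _ (rpow (c * (/ 2) ^ k) p)).
      apply: rpow_le; [lra | split; [exact: abs_ge_0 | exact: h]].
    rewrite rpowM //; last lra.
    apply: Rmult_le_compat_l; first exact: rpow_ge0.
    by apply: rpow_le_self => //; lra.
  have -> : sum_n (fun k => rpow c p * (/ 2) ^ k) n = rpow c p * sum_n (fun k => (/ 2) ^ k) n.
    exact: (sum_n_mult_l (K := R_AbsRing) (rpow c p)).
  rewrite sum_half_pow rpowM //; last lra.
  have := rpow_bernoulli 2 p hp ltac:(lra); have := rpow_ge0 c p.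
  have := half_pow_bounds n; nra.
have hx : in_space X x.
  case: X hs => [p hp|] hs; first exact: in_lp_of_bound hs.
  apply: (is_lim_seq_le_le (fun _ => 0) _ (fun k => c * (/ 2) ^ k)).
  - by move=> k; split; [exact: abs_ge_0 | exact: h].
  - exact: is_lim_seq_const.
  - have -> : Finite 0 = Rbar_mult c 0 by rewrite /= Rmult_0_r.
    apply: is_lim_seq_scal_l; apply: is_lim_seq_geom.
    rewrite Rabs_pos_eq; lra.
by split=> //; apply/seq_norm_leP => //; lra.
Qed.

Lemma finite_support_dense {K : AbsRing} {X : seq_space} (y : seqs K X) (eps : R) :
  0 < eps -> exists (z : seqs K X) (d : nat),
  (forall k, (d <= k)%nat -> z k = zero) /\ seqs_norm (minus z y) < eps.
Proof.
move=> he.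
pose t d k : K := if le_lt_dec d k is left _ then zero else y k.
have tin d : in_space X (t d).
  have hX := seqsP y; rewrite /t.
  case: X y hX @t => [p hp|] y hX t /=.
    apply/(ex_series_incr_n _ d).
    apply: (ex_series_ext (fun _ => 0)) => [k|]; last first.
      by exists 0; apply: is_lim_seq_ext (is_lim_seq_const 0) => n;
        rewrite sum_n_const Rmult_0_r.
    by case: le_lt_dec => [_|hk]; [rewrite abs_zero rpow0 | lia].
  apply: (is_lim_seq_ext_loc (fun _ => 0)); last exact: is_lim_seq_const.
  by exists d => k hk; case: le_lt_dec => [_|hk']; [rewrite abs_zero | lia].
have tE d k : abs (minus (t d k) (y k)) = if le_lt_dec d k is left _ then abs (y k) else 0.
  rewrite /t; case: le_lt_dec => _; last by rewrite minus_eq_zero abs_zero.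
  by rewrite /minus plus_zero_l abs_opp.
suff [d hd] : exists d, forall n, sect_le X n (fun k => abs (minus (t d k) (y k))) (eps / 2).
  exists (Seqs (t d) (tin d)), d; split.
    by move=> k hk /=; rewrite /t; case: le_lt_dec => //; lia.
  apply: (Rle_lt_trans _ (eps / 2)); last lra.
  by apply/(seq_norm_leP X _ _ (seqsP (minus (Seqs (t d) (tin d)) y))); [lra | exact: hd].
have hX := seqsP y.
case: X y hX t tin tE => [p hp|] y hX t tin tE /=.
- pose a k := rpow (abs (y k)) p.
  have a0 k : 0 <= a k by exact: rpow_ge0.
  have hlim : is_lim_seq (sum_n a) (Series a) by exact: Series_correct hX.
  have hpos : 0 < rpow (eps / 2) p by apply: rpow_gt0; lra.
  have hle n : sum_n a n <= Series a.
    apply: (is_lim_seq_incr_compare _ _ hlim) => m.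
    rewrite sum_Sn /plus /=; have := a0 (S m); lra.
  have /is_lim_seq_spec /(_ (mkposreal _ hpos)) [N hN] := hlim.
  have {hN} := hN N (Nat.le_refl _) => /= /Rabs_lt_between' hN.
  exists (S N) => n.
  apply: (Rle_trans _ (sum_n a n - sum_n a (Nat.min n N))); last first.
    case: (Nat.le_gt_cases n N) => hn; first by rewrite Nat.min_l //; lra.
    rewrite Nat.min_r; last lia.
    have := hle n; lra.
  (* Truncation removes exactly the partial sum up to index [min n N]. *)
  right; elim: n => [|n IH].
    by rewrite /= !sum_O tE; case: le_lt_dec => [|_]; [lia | rewrite rpow0; lra].
  rewrite !(sum_Sn _ n) IH tE.
  case: le_lt_dec => hn.
    rewrite !Nat.min_r; try lia; rewrite /plus /= -/(a (S n)); lra.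
  rewrite (Nat.min_l (S n)) ?(Nat.min_l n); try lia.
  by rewrite (sum_Sn _ n) rpow0 /plus /=; lra.
- have he2 : 0 < eps / 2 by lra.
  have /is_lim_seq_spec /(_ (mkposreal _ he2)) [N hN] := hX.
  exists N => n; rewrite tE; case: le_lt_dec => hn; last lra.
  have := hN n hn => /=; rewrite Rminus_0_r Rabs_pos_eq; [lra | exact: abs_ge_0].
Qed.

(** * Reduction to the unweighted shift *)

Section Unweighting.
Context {F : ground_field} (X : seq_space).
Context {lambda mu : scalars F} (hmu : mult lambda mu = one) (mu_lt1 : abs mu < 1).
Notation A := (weighted_shift X lambda).
Notation E := (seqs (scalars F) X).

(** The product of [a^i] for [1 <= i <= k], that is [a] to the [k]-th triangular
    number. *)
Fixpoint weight (a : scalars F) (k : nat) : scalars F :=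
  match k with O => one | S k' => mult (weight a k') (pow_n a (S k')) end.

Lemma pow_n_inv n : mult (pow_n lambda n) (pow_n mu n) = one.
Proof.
elim: n => [|n IH] /=; first exact: mult_one_l.
rewrite (scalars_multC _ mu) mult_assoc -(mult_assoc lambda) IH mult_one_r; exact: hmu.
Qed.

Lemma weight_inv k : mult (weight mu k) (weight lambda k) = one.
Proof.
elim: k => [|k IH]; first exact: mult_one_l.
rewrite /= -!/(pow_n _ (S k)) (scalars_multC _ (weight lambda k)) mult_assoc.
rewrite -(mult_assoc (weight mu k)) (scalars_multC _ (mult mu _)).
by rewrite (pow_n_inv (S k)) mult_one_r.
Qed.

Definition exp_growth (u : nat -> scalars F) : Prop :=
  exists M b, 0 <= b /\ forall k, abs (u k) <= M * b ^ k.

Lemma exp_growth_shift u n : exp_growth u -> exp_growth (fun k => u (k + n)%nat).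
Proof.
case=> M [b [hb h]]; exists (M * b ^ n), b; split=> // k.
by rewrite Rmult_assoc -pow_add (Nat.add_comm n).
Qed.

(** Consecutive terms have ratio at most [|mu|^(k+1) * b], which tends to [0];
    from some index on the sequence is therefore halved at every step. *)
Lemma weight_decay b : 0 <= b -> is_lim_seq (fun k => abs (weight mu k) * b ^ k) 0.
Proof.
move=> hb.
have m0 := abs_ge_0 mu.
have step k : abs (weight mu (S k)) * b ^ S k <=
    (abs mu ^ S k * b) * (abs (weight mu k) * b ^ k).
  have h1 := abs_mult (weight mu k) (pow_n mu (S k)).
  have h2 := abs_pow_n mu (S k).
  have w0 := abs_ge_0 (weight mu k).
  have b0 := pow_le b k hb.
  have -> : abs mu ^ S k * b * (abs (weight mu k) * b ^ k) =
    abs (weight mu k) * abs mu ^ S k * (b * b ^ k).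
    by ring.
  apply: Rmult_le_compat_r; first exact: (pow_le b (S k) hb).
  apply: Rle_trans h1 _; exact: Rmult_le_compat_l.
have [N hN] : exists N, forall k, (N <= k)%nat -> abs mu ^ S k * b <= / 2.
  have pb : 0 < / (2 * (b + 1)) by apply: Rinv_0_lt_compat; lra.
  have [|N hN] := pow_lt_1_zero (abs mu) _ _ pb; first by rewrite Rabs_pos_eq.
  exists N => k hk; have := hN (S k) ltac:(lia).
  have p0 := pow_le _ (S k) m0.
  rewrite Rabs_pos_eq // => h.
  have e : / (2 * (b + 1)) * (b + 1) = / 2 by field; lra.
  nra.
apply/(is_lim_seq_incr_n _ N).
pose a k := abs (weight mu k) * b ^ k.
have a0 k : 0 <= a k by apply: Rmult_le_pos; [exact: abs_ge_0 | exact: pow_le].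
apply: (is_lim_seq_le_le (fun _ => 0) _ (fun k => a N * (/ 2) ^ k)).
- move=> k; split; first exact: (a0 (k + N)%nat).
  elim: k => [|k IH]; first by rewrite /a /=; lra.
  have := step (k + N)%nat; have := hN (k + N)%nat ltac:(lia); have := a0 (k + N)%nat.
  have -> : (S k + N)%nat = S (k + N) by [].
  rewrite /a in IH *; rewrite -!tech_pow_Rmult in IH *; nra.
- exact: is_lim_seq_const.
- have -> : Finite 0 = Rbar_mult (a N) 0 by rewrite /= Rmult_0_r.
  apply: is_lim_seq_scal_l; apply: is_lim_seq_geom; rewrite Rabs_pos_eq; lra.
Qed.

(** The threshold depends on the growth of the unweighted sequence only through
    [M] and [b]; this uniformity controls the remainders of all the iterates of
    one vector, and of periodic vectors of any period. *)
Lemma weight_small M b eps : 0 <= b -> 0 < eps ->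
  exists N, forall k, (N <= k)%nat ->
    abs (weight mu k) * (M * b ^ k) <= eps * (/ 2) ^ k.
Proof.
move=> hb he.
have M1 : 0 < Rabs M + 1 by have := Rabs_pos M; lra.
have he' : 0 < eps / (Rabs M + 1) by exact: Rdiv_lt_0_compat.
have /is_lim_seq_spec /(_ (mkposreal _ he')) [N hN] := weight_decay (2 * b) ltac:(lra).
exists N => k /hN /=; rewrite Rminus_0_r.
have w0 := abs_ge_0 (weight mu k); have b0 := pow_le b k hb.
have p2 : 0 < 2 ^ k by apply: pow_lt; lra.
rewrite Rpow_mult_distr Rabs_pos_eq; last by apply: Rmult_le_pos => //; nra.
rewrite pow_inv; move=> h.
have e : eps / (Rabs M + 1) * (Rabs M + 1) = eps by field; lra.
apply: (Rmult_le_reg_r (2 ^ k)) => //.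
rewrite (Rmult_assoc eps) Rinv_l; last lra.
have hM := Rle_abs M.
have h0 : 0 <= abs (weight mu k) * (2 ^ k * b ^ k) by apply: Rmult_le_pos => //; nra.
have -> : abs (weight mu k) * (M * b ^ k) * 2 ^ k =
  abs (weight mu k) * (2 ^ k * b ^ k) * M by ring.
nra.
Qed.

Lemma weighted_in_space u : exp_growth u -> in_space X (fun k => mult (weight mu k) (u k)).
Proof.
case=> M [b [hb h]].
have [B hB] := is_lim_seq0_bounded _ (weight_decay (2 * b) ltac:(lra)).
apply: (proj1 (geometric_seq_norm X _ (B * Rabs M) _)) => k.
have w0 := abs_ge_0 (weight mu k); have b0 := pow_le b k hb.
apply: Rle_trans (abs_mult _ _) _.
have p2 : 0 < 2 ^ k by apply: pow_lt; lra.
have := hB k; rewrite Rpow_mult_distr pow_inv => h1.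
apply: (Rmult_le_reg_r (2 ^ k)) => //.
rewrite (Rmult_assoc (B * Rabs M)) Rinv_l; last lra.
have hu := h k; have hM := Rle_abs M.
have : abs (weight mu k) * abs (u k) <= abs (weight mu k) * (Rabs M * b ^ k).
  by apply: Rmult_le_compat_l => //; nra.
have := Rabs_pos M; nra.
Qed.

(** The diagonal change of variables, as a relation: a vector of the space has a
    proof component, and the relation spares carrying it along. *)
Definition unweights (x : E) (u : nat -> scalars F) : Prop :=
  forall k, x k = mult (weight mu k) (u k).

Lemma unweights_exists u : exp_growth u -> exists x, unweights x u.
Proof. by move=> hu; exists (Seqs _ (weighted_in_space u hu)). Qed.

Lemma shift_seq_unweights x u : unweights x u ->
  shift_seq lambda x = fun k => mult (weight mu k) (u (S k)).
Proof.
move=> h; apply: functional_extensionality => k.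
rewrite /shift_seq h.
have -> : weight mu (S k) = mult (weight mu k) (pow_n mu (S k)) by [].
rewrite (scalars_multC _ (weight mu k) (pow_n _ _)) (mult_assoc (pow_n _ _)).
rewrite (mult_assoc (pow_n _ _) (pow_n _ _)).
by rewrite (pow_n_inv (S k)) mult_one_l.
Qed.

(** The change of variables turns the weighted shift into the plain one. *)
Lemma op_pow_unweights x u n : exp_growth u -> unweights x u ->
  dom (op_pow A n) x /\ unweights (app (op_pow A n) x) (fun k => u (k + n)%nat).
Proof.
move=> hu hx; elim: n => [|n [IH1 IH2]].
  by split=> // k; rewrite Nat.add_0_r; exact: hx.
have e := shift_seq_unweights _ _ IH2.
have hd : dom A (app (op_pow A n) x).
  rewrite /= e; apply: weighted_in_space.
  have := exp_growth_shift _ (S n) hu; case=> M [b [hb h]]; exists M, b; split=> // k.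
  by have := h k; rewrite Nat.add_succ_r.
split=> // k.
have /= -> := weighted_shiftE X lambda _ k hd.
have := f_equal (fun f => f k) e; rewrite /shift_seq /= => ->.
by rewrite Nat.add_succ_r.
Qed.

Lemma weight_inv_l k (t : scalars F) : mult (weight mu k) (mult (weight lambda k) t) = t.
Proof. by rewrite mult_assoc weight_inv mult_one_l. Qed.

(** * Unboundedness and chaos *)

(** Eigenvectors for the eigenvalues [lambda^N], with [N] large, rule out a bound
    [M]. *)
Lemma weighted_shift_unbounded : ~ bounded_operator A.
Proof.
case=> M hM; have m0 := abs_ge_0 mu.
have M1 : 0 < Rabs M + 1 by have := Rabs_pos M; lra.
have [|N hN] := pow_lt_1_zero (abs mu) _ _ (Rinv_0_lt_compat _ M1).
  by rewrite Rabs_pos_eq.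
have {hN} := hN N (Nat.le_refl _); rewrite Rabs_pos_eq => [hN|]; last exact: pow_le.
pose s := pow_n lambda N.
pose u k := pow_n s k.
have hu : exp_growth u.
  exists 1, (abs s); split; first exact: abs_ge_0.
  by move=> k; rewrite Rmult_1_l; exact: abs_pow_n.
have [x hx] := unweights_exists _ hu.
have [[_ hd] hA] := op_pow_unweights _ _ 1 hu hx.
have {}hA k : (app A x : E) k = mult s (x k).
  have := hA k; rewrite /= => ->.
  rewrite hx Nat.add_1_r /u /= mult_assoc (scalars_multC _ (weight mu k)) -mult_assoc.
  by [].
have {}hM : norm (app A x) <= M * norm x := hM x hd.
have ex : x = scal (pow_n mu N) (app A x : E).
  apply: seqs_eq => k; change (x k = mult (pow_n mu N) ((app A x : E) k)).
  by rewrite hA mult_assoc (scalars_multC _ _ s) pow_n_inv mult_one_l.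
have hs : seqs_norm x <= abs (pow_n mu N) * seqs_norm (app A x : E).
  by rewrite {1}ex; exact: seqs_norm_scal.
have hx0 : 1 <= seqs_norm x.
  have := coord_le_norm X x O (seqsP x); rewrite hx /u /= mult_one_l.
  by rewrite (@abs_one (scalars F)).
have {}hM : seqs_norm (app A x : E) <= M * seqs_norm x := hM.
have hp := abs_pow_n mu N; have ap := abs_ge_0 (pow_n mu N).
have n0 : 0 <= seqs_norm (app A x : E) by exact: seq_norm_ge0.
have p0 := pow_le _ N m0.
have e : / (Rabs M + 1) * (Rabs M + 1) = 1 by field; lra.
have hMa := Rle_abs M.
have h1 : abs mu ^ N * (Rabs M + 1) < 1 by nra.
have h2 : seqs_norm x <= abs mu ^ N * ((Rabs M + 1) * seqs_norm x).
  apply: Rle_trans hs _; apply: Rmult_le_compat => //; nra.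
nra.
Qed.

(** Weighting a universal sequence gives a hypercyclic vector. *)
Lemma weighted_shift_hypercyclic : hypercyclic A.
Proof.
have [u [hub hu]] := universal_sequence F.
have pow_lin n : INR n <= 2 ^ n.
  by elim: n => [|n IH]; rewrite ?S_INR /=; [lra | have := pow_R1_Rle 2 n ltac:(lra); lra].
have hg : exp_growth u.
  by exists 1, 2; split; [lra | move=> k; have := hub k; have := pow_lin k; lra].
have [x hx] := unweights_exists _ hg.
have hd : dense (orbit A x).
  move=> y eps; have he := cond_pos eps.
  have [z [d [hz hzy]]] := finite_support_dense y (eps / 2) ltac:(lra).
  (* The geometric bound costs a factor [2], so that [2 * c] is below [eps / 2]. *)
  pose c := eps / 8.
  have c0' : 0 < c by rewrite /c; lra.
  (* For [k >= n] one has [|u (k + n)| <= 2 * k <= 2 * 2^k]. *)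
  have [N hN] := weight_small 2 2 c ltac:(lra) c0'.
  pose delta k := c * (/ 2) ^ k / (abs (weight mu k) + 1).
  have w0 k : 0 < abs (weight mu k) + 1 by have := abs_ge_0 (weight mu k); lra.
  have hdelta k : 0 < delta k.
    apply: Rdiv_lt_0_compat => //; apply: Rmult_lt_0_compat => //.
    by case: (half_pow_bounds k).
  have [n [hn [hnear hzero]]] := hu (fun k => mult (weight lambda k) (z k)) delta d N hdelta.
  have [_ hAn] := op_pow_unweights _ _ n hg hx.
  exists (app (op_pow A n) x); split; first by exists n.
  apply: seqs_norm_ball1; set w : E := app (op_pow A n) x.
  have -> : minus w y = plus (minus w z) (minus z y) by rewrite -minus_trans.
  apply: Rle_lt_trans (seqs_norm_triangle _ _) _.
  suff : seqs_norm (minus w z) <= 2 * c by rewrite /c; lra.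
  apply: (proj2 (geometric_seq_norm X _ c _)) => k.
  change (abs (minus (w k) (z k)) <= c * (/ 2) ^ k).
  have wk := hAn k; rewrite -/w in wk; rewrite {}wk.
  have hk0 := half_pow_bounds k.
  case: (le_lt_dec d k) => hk; last first.
    have -> : minus (mult (weight mu k) (u (k + n)%nat)) (z k) =
      mult (weight mu k) (minus (u (k + n)%nat) (mult (weight lambda k) (z k))).
      by rewrite /minus mult_distr_l -opp_mult_r weight_inv_l.
    apply: Rle_trans (abs_mult _ _) _.
    have := hnear k hk; rewrite /delta => h.
    have e : c * (/ 2) ^ k / (abs (weight mu k) + 1) * (abs (weight mu k) + 1) = c * (/ 2) ^ k.
      by field; have := w0 k; lra.
    have := abs_ge_0 (weight mu k); have := hdelta k; rewrite /delta; nra.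
  rewrite hz // minus_zero_r.
  case: (le_lt_dec n k) => hkn; last first.
    by rewrite hzero // mult_zero_r abs_zero; nra.
  apply: Rle_trans (hN k ltac:(lia)).
  apply: Rle_trans (abs_mult _ _) _; apply: Rmult_le_compat_l; first exact: abs_ge_0.
  apply: Rle_trans (hub _) _; rewrite plus_INR.
  by have := pow_lin k; have := le_INR _ _ hkn; lra.
exists x; split; last split=> //.
  (* If the vector vanished, so would [u] and the whole orbit, which then could
     not come close to a vector whose entry of index [0] is [1]. *)
  move=> x0.
  have g1 : exp_growth (fun _ => one).
    by exists 1, 1; split; [lra | move=> k; rewrite pow1 (@abs_one (scalars F)); lra].
  have [y hy] := unweights_exists _ g1.
  have [_ [[n ->] hball]] := hd y (mkposreal 1 Rlt_0_1).
  have {}hball : seqs_norm (minus (app (op_pow A n) x : E) y) < 1 := hball.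
  have := coord_le_norm X _ O (seqsP (minus (app (op_pow A n) x : E) y)).
  change (abs (minus ((app (op_pow A n) x : E) O) (y O)) <=
    seqs_norm (minus (app (op_pow A n) x : E) y) -> False).
  have [_ /(_ O) ->] := op_pow_unweights _ _ n hg hx.
  have -> : u (0 + n)%nat = zero.
    have := hx n; rewrite x0 => h.
    rewrite -(mult_one_l (u _)) -(weight_inv n) (scalars_multC _ (weight mu n)) -mult_assoc.
    by rewrite -h mult_zero_r.
  rewrite mult_zero_r hy /= mult_one_l /minus plus_zero_l abs_opp (@abs_one (scalars F)).
  exact: Rlt_not_le.
move=> n; exact: (proj1 (op_pow_unweights _ _ n hg hx)).
Qed.

Lemma weighted_shift_periodic_dense : dense (periodic_point A).
Proof.
move=> y eps; have he := cond_pos eps.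
have [z [d [hz hzy]]] := finite_support_dense y (eps / 2) ltac:(lra).
pose c := eps / 8.
have c0' : 0 < c by rewrite /c; lra.
pose v k := mult (weight lambda k) (z k).
have [M hM] : exists M, forall k, abs (v k) <= M.
  apply: is_lim_seq0_bounded; apply: (is_lim_seq_ext_loc (fun _ => 0)).
    by exists d => k hk; rewrite /v hz // mult_zero_r abs_zero.
  exact: is_lim_seq_const.
have [N hN] := weight_small M 1 c ltac:(lra) c0'.
(* Not below [d], to hold the target in one period, nor [N], to make the rest
   small; the successor makes it positive. *)
pose P := S (d + N).
pose u k := v (k mod P)%nat.
have hg : exp_growth u.
  by exists M, 1; split; [lra | move=> k; rewrite pow1 Rmult_1_r; exact: hM].
have [x hx] := unweights_exists _ hg.
exists x; split.
  have [h1 h2] := op_pow_unweights _ _ P hg hx.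
  exists P; split; first by rewrite /P; lia.
  split=> //; apply: seqs_eq => k; rewrite h2 hx /u.
  congr (mult _ (v _)); rewrite -{1}(Nat.mul_1_l P); exact: Nat.Div0.mod_add.
apply: seqs_norm_ball1.
have -> : minus x y = plus (minus x z) (minus z y) by rewrite -minus_trans.
apply: Rle_lt_trans (seqs_norm_triangle _ _) _.
suff : seqs_norm (minus x z) <= 2 * c by rewrite /c; lra.
apply: (proj2 (geometric_seq_norm X _ c _)) => k.
change (abs (minus (x k) (z k)) <= c * (/ 2) ^ k).
rewrite hx /u.
case: (le_lt_dec P k) => hk; last first.
  rewrite Nat.mod_small // /v weight_inv_l minus_eq_zero abs_zero.
  have := half_pow_bounds k; nra.
rewrite hz ?minus_zero_r; last by rewrite /P in hk; lia.
apply: Rle_trans (hN k ltac:(rewrite /P in hk; lia)).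
apply: Rle_trans (abs_mult _ _) _; apply: Rmult_le_compat_l; first exact: abs_ge_0.
by rewrite pow1 Rmult_1_r; exact: hM.
Qed.

End Unweighting.

Lemma weighted_shift_linear F X (lambda : scalars F) :
  linear_operator (weighted_shift X lambda).
Proof.
have val (x : seqs (scalars F) X) : dom (weighted_shift X lambda) x ->
  seqs_val (app (weighted_shift X lambda) x) = shift_seq lambda x.
  move=> h; apply: functional_extensionality => k.
  exact: weighted_shiftE.
have sD (x y : seqs (scalars F) X) : shift_seq lambda (plus x y) =
  fun k => plus (shift_seq lambda x k) (shift_seq lambda y k).
  apply: functional_extensionality => k; exact: mult_distr_l.
have sZ a (x : seqs (scalars F) X) : shift_seq lambda (scal a x) =
  fun k => mult a (shift_seq lambda x k).
  apply: functional_extensionality => k.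
  change (mult (pow_n lambda (S k)) (mult a (x (S k))) =
    mult a (mult (pow_n lambda (S k)) (x (S k)))).
  by rewrite mult_assoc (scalars_multC _ (pow_n _ _) a) -mult_assoc.
split; last split.
- suff h : shift_seq lambda (zero : seqs (scalars F) X) = fun _ => zero.
    by rewrite /= h; exact: in_space_zero.
  apply: functional_extensionality => k; exact: mult_zero_r.
- move=> x y hx hy.
  have hd : dom (weighted_shift X lambda) (plus x y).
    rewrite /= (sD x y); exact: in_space_plus hx hy.
  split=> //; apply: seqs_eq => k; rewrite (val _ hd) (sD x y) -(val _ hx) -(val _ hy).
  by [].
- move=> a x hx.
  have hd : dom (weighted_shift X lambda) (scal a x).
    rewrite /= (sZ a x); exact: in_space_scal hx.
  by split=> //; apply: seqs_eq => k; rewrite (val _ hd) (sZ a x) -(val _ hx).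
Qed.

Theorem corollary4p1 (F : ground_field) (X : seq_space) (lambda : scalars F)
    (hlambda : 1 < abs lambda) :
  linear_operator (weighted_shift X lambda) /\
  ~ bounded_operator (weighted_shift X lambda) /\
  chaotic (weighted_shift X lambda).
Proof.
have [mu [hmu mu1]] := scalars_inv F lambda hlambda.
split; first exact: weighted_shift_linear.
split; first exact: weighted_shift_unbounded hmu mu1.
split; first exact: weighted_shift_hypercyclic hmu mu1.
exact: weighted_shift_periodic_dense hmu mu1.
Qed.
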